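(* For each fixed integer $r$, the problem TOTAL DOMINATING SET is polynomial time solvable on each of the following graph classes: (a) $(P_4\cup rK_1)$-free graphs, (b) $(P_3\cup rK_1)$-free graphs, (c) $(K_2\cup rK_1)$-free graphs, (d) $rK_1$-free graphs.
   Context: All graphs are finite, simple and undirected. A vertex subset $D$ of a graph $G$ is a total dominating set if every vertex of $G$ is adjacent to some vertex of $D$. TOTAL DOMINATING SET: given a graph $G$ and a positive integer $k\leq |V(G)|$, decide whether $G$ has a total dominating set of size at most $k$. A graph $G$ is $H$-free if no induced subgraph of $G$ is isomorphic to $H$. $P_t$ is the path on $t$ vertices, $K_2$ is an edge, $\cup$ denotes disjoint union, and $rK_1$ is the edgeless graph on $r$ vertices. *)

(* Defs.v *)
From mathcomp Require Import all_boot all_algebra.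

Set Implicit Arguments.
Unset Strict Implicit.
Unset Printing Implicit Defensive.

Record sgraph := SGraph {
  vert :> finType;
  adj : rel vert;
  adj_sym : symmetric adj;
  adj_irr : irreflexive adj }.

Definition total_dominating (G : sgraph) (D : {set G}) : Prop :=
  forall v : G, exists2 u : G, u \in D & adj v u.

Section Induced.
Variables (G : sgraph) (S : {set G}).
Definition induced_adj : rel {x : G | x \in S} :=
  fun x y => adj (val x) (val y).
Lemma induced_adj_sym : symmetric induced_adj.
Proof. by move=> x y; apply: adj_sym. Qed.
Lemma induced_adj_irr : irreflexive induced_adj.
Proof. by move=> x; apply: adj_irr. Qed.
Definition induced : sgraph := SGraph induced_adj_sym induced_adj_irr.
End Induced.

Definition isomorphic (G H : sgraph) : Prop :=
  exists2 f : G -> H, bijective f & forall x y, adj (f x) (f y) = adj x y.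

Definition free_of (H G : sgraph) : Prop :=
  forall S : {set G}, ~ isomorphic (induced S) H.

Section Path.
Variable t : nat.
Definition path_adj : rel 'I_t :=
  fun i j => (i.+1 == j :> nat) || (j.+1 == i :> nat).
Lemma path_adj_sym : symmetric path_adj.
Proof. by move=> i j; rewrite /path_adj orbC. Qed.
Lemma path_adj_irr : irreflexive path_adj.
Proof. by move=> i; rewrite /path_adj orbb; apply/negbTE; rewrite neq_ltn ltnSn orbT. Qed.
Definition path_graph : sgraph := SGraph path_adj_sym path_adj_irr.
End Path.

Section Complete.
Variable t : nat.
Definition complete_adj : rel 'I_t := fun i j => i != j.
Lemma complete_adj_sym : symmetric complete_adj.
Proof. by move=> i j; rewrite /complete_adj eq_sym. Qed.
Lemma complete_adj_irr : irreflexive complete_adj.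
Proof. by move=> i; rewrite /complete_adj eqxx. Qed.
Definition complete_graph : sgraph := SGraph complete_adj_sym complete_adj_irr.
End Complete.

Section Edgeless.
Variable r : nat.
Definition edgeless_adj : rel 'I_r := fun _ _ => false.
Lemma edgeless_adj_sym : symmetric edgeless_adj.
Proof. by []. Qed.
Lemma edgeless_adj_irr : irreflexive edgeless_adj.
Proof. by []. Qed.
Definition edgeless_graph : sgraph := SGraph edgeless_adj_sym edgeless_adj_irr.
End Edgeless.

Section DisjointUnion.
Variables G H : sgraph.
Definition dunion_adj : rel (G + H)%type := fun x y =>
  match x, y with
  | inl a, inl b => adj a b
  | inr a, inr b => adj a b
  | _, _ => false
  end.
Lemma dunion_adj_sym : symmetric dunion_adj.
Proof. by case=> a [] b //=; apply: adj_sym. Qed.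
Lemma dunion_adj_irr : irreflexive dunion_adj.
Proof. by case=> a /=; apply: adj_irr. Qed.
Definition dunion : sgraph := SGraph dunion_adj_sym dunion_adj_irr.
End DisjointUnion.

Inductive move := MoveL | MoveN | MoveR.

(* [None] is the blank; [Some (inl b)] is the input symbol [b]; the symbols
   [Some (inr _)] are auxiliary. *)
Definition tape_symbol (X : finType) : finType := option (bool + X).

(* [tm_verdict q] is [Some b] if [q] is a halting state with answer [b], and
   [None] otherwise.  A machine has [tm_aux.+1] tapes, one-way infinite, with
   cells numbered from 0; tape [ord0] receives the input. *)
Record tm := TM {
  tm_state : finType;
  tm_extra : finType;
  tm_aux : nat;
  tm_start : tm_state;
  tm_verdict : tm_state -> option bool;
  tm_trans : tm_state -> {ffun 'I_tm_aux.+1 -> tape_symbol tm_extra} ->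
    tm_state * ('I_tm_aux.+1 -> tape_symbol tm_extra * move) }.

Record config (M : tm) := Config {
  cf_state : tm_state M;
  cf_head : 'I_(tm_aux M).+1 -> nat;
  cf_tape : 'I_(tm_aux M).+1 -> nat -> tape_symbol (tm_extra M) }.

(* On cell 0 a left move leaves the head in place. *)
Definition move_head (d : move) (h : nat) : nat :=
  match d with MoveL => h.-1 | MoveN => h | MoveR => h.+1 end.

Definition tm_step (M : tm) (c : config M) : config M :=
  if tm_verdict (cf_state c) is Some _ then c else
  let: (q, act) :=
    tm_trans (cf_state c) [ffun i => cf_tape c i (cf_head c i)] in
  Config q
    (fun i => move_head (act i).2 (cf_head c i))
    (fun i p => if p == cf_head c i then (act i).1 else cf_tape c i p).

(* All heads start on cell 0.  The input occupies cells 1, ..., [size w] of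
   tape [ord0], so that the blank in cell 0 marks its left end. *)
Definition tm_init (M : tm) (w : seq bool) : config M :=
  Config (tm_start M) (fun=> 0)
    (fun i => nth None
       (if i == ord0 then None :: [seq Some (inl b) | b <- w] else [::])).

Definition tm_answers_within (M : tm) (w : seq bool) (T : nat) (b : bool) :
    Prop :=
  exists2 t, t <= T & tm_verdict (cf_state (iter t (@tm_step M) (tm_init M w)))
                      = Some b.

(* The decision problem with instance set [dom], encoding [enc] and
   yes-instances [yes]; nothing is required of the machine on words that do
   not encode an element of [dom]. *)
Definition polytime_solvable (I : Type) (enc : I -> seq bool)
    (dom yes : I -> Prop) : Prop :=
  exists (M : tm) (p : {poly nat}), forall x : I, dom x ->
    exists2 b : bool,
      tm_answers_within M (enc x) (p.[size (enc x)])%R b & (b <-> yes x).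

(* The word 1^n 0 1^k 0 followed by the n x n adjacency matrix, row by row,
   where n is the number of vertices.  As k <= n on instances, writing k in
   unary is harmless.  Every adjacency matrix arises, from graphs on ['I_n]. *)
Definition encode_tds (x : sgraph * nat) : seq bool :=
  let: (G, k) := x in
  nseq #|G| true ++ false :: nseq k true ++ false ::
  [seq adj u v | u <- enum G, v <- enum G].

Definition tds_instance (C : sgraph -> Prop) (x : sgraph * nat) : Prop :=
  C x.1 /\ 0 < x.2 <= #|x.1|.

Definition tds_yes (x : sgraph * nat) : Prop :=
  exists2 D : {set x.1}, total_dominating D & #|D| <= x.2.

Definition tds_polytime_on (C : sgraph -> Prop) : Prop :=
  polytime_solvable encode_tds (tds_instance C) tds_yes.

(* Main.v *)
Require Import Defs.
From mathcomp Require Import all_boot all_algebra zify.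
From Stdlib Require Import FunctionalExtensionality.

(* Let [G] be [(P4 + rK1)]-free without isolated vertices.  If [G] contains an induced [P4],
   a maximal independent set of vertices not dominated by this path has fewer than [r]
   elements, and adding it and one neighbour of each of its elements gives a total dominating
   set of size at most [K = 2r + 4].  If [G] is [P4]-free, then every component has diameter at
   most 2 and a dominating edge, so the least size is twice the number of components.  Hence
   it suffices to try all sets of at most [K] vertices and, if none works and [K <= k], to
   compare [k] with twice the number of vertices having no smaller vertex at distance at
   most 2.  Both are finitely many nested quantifiers over vertices, and a Turing machine with
   one tape per quantified variable evaluates them in polynomial time.  The classes (b), (c)
   and (d) are contained in (a). *)

Set Implicit Arguments.
Unset Strict Implicit.
Unset Printing Implicit Defensive.

(** * Structured programs on multitape machines *)

Section Programs.
Variable m : nat.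
Notation sym := (tape_symbol bool).
Notation reading := {ffun 'I_m.+1 -> sym}.

(** A configuration without its control state, so that programs with different state types act on
    the same object. *)
Record memory := Memory { head : 'I_m.+1 -> nat; tape : 'I_m.+1 -> nat -> sym }.

(* Every command ends by returning an [option bool]: [If] takes its first branch on
   [Some true] only, and [Loop] repeats its body for as long as that returns [None]. *)
Inductive cmd :=
| Ret of option bool
| Act of (nat -> option sym) & (nat -> move)
| Test of nat & sym
| If of cmd & cmd & cmd
| Loop of cmd.

Fixpoint st (c : cmd) : finType :=
  match c with
  | If c0 c1 c2 => (st c0 + (st c1 + st c2))%type
  | Loop c => st c
  | _ => unit
  end.

Fixpoint start (c : cmd) : st c :=
  match c with
  | If c0 c1 c2 => inl (start c0)
  | Loop c => start c
  | _ => tt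
  end.

Definition action := 'I_m.+1 -> sym * move.

(** [inr r] means that the command ends with this very step. The last step of a condition or of a
    loop body already enters the next command, so passing control costs no time. *)
Fixpoint step (c : cmd) : st c -> reading -> (st c + option bool) * action :=
  match c with
  | Ret r => fun _ f => (inr r, fun i => (f i, MoveN))
  | Act wr mv => fun _ f => (inr None, fun i => (odflt (f i) (wr i), mv i))
  | Test i s => fun _ f => (inr (Some (f (inord i) == s)), fun i => (f i, MoveN))
  | If c0 c1 c2 => fun s f =>
      match s with
      | inl s0 => let: (o, a) := step s0 f in
          (match o with
           | inl s' => inl (inl s')
           | inr (Some true) => inl (inr (inl (start c1)))
           | inr _ => inl (inr (inr (start c2)))
           end, a)
      | inr (inl s1) => let: (o, a) := step s1 f in
          (match o with inl s' => inl (inr (inl s')) | inr r => inr r end, a)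
      | inr (inr s2) => let: (o, a) := step s2 f in
          (match o with inl s' => inl (inr (inr s')) | inr r => inr r end, a)
      end
  | Loop c => fun s f => let: (o, a) := @step c s f in
      (match o with
       | inl s' => inl s'
       | inr None => inl (start c)
       | inr (Some b) => inr (Some b)
       end, a)
  end.

Definition reads (M : memory) : reading := [ffun i => tape M i (head M i)].

Definition act (a : action) (M : memory) : memory :=
  Memory (fun i => move_head (a i).2 (head M i))
      (fun i p => if p == head M i then (a i).1 else tape M i p).

Inductive run (c : cmd) : st c -> memory -> nat -> memory -> option bool -> Prop :=
| RunExit s M r a : step s (reads M) = (inr r, a) -> run s M 1 (act a M) r
| RunStep s M s' a T M' r : step s (reads M) = (inl s', a) ->
    run s' (act a M) T M' r -> run s M T.+1 M' r.

Definition machine (c : cmd) : tm :=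
  @TM (st c + option bool)%type bool m (inl (start c))
    (fun q => match q with inl _ => None | inr r => Some (odflt false r) end)
    (fun q f => match q with
                | inl s => step s f
                | inr r => (inr r, fun i => (f i, MoveN))
                end).

Definition cfg c (q : st c + option bool) (M : memory) : config (machine c) :=
  @Config (machine c) q (head M) (tape M).

Lemma run_machine c (s : st c) M T M' r : run s M T M' r ->
  iter T (@tm_step (machine c)) (cfg (inl s) M) = cfg (inr r) M'.
Proof.
elim=> {s M T M' r} [s M r a E|s M s' a T M' r E _ IH].
  by rewrite /= /tm_step /= -/(reads M) E.
rewrite iterSr -IH; congr iter.
by rewrite /tm_step /= -/(reads M) E.
Qed.

(** Times are upper bounds, so that they can be rounded up when programs are composed. *)
Definition runs c M T M' r := exists2 T', T' <= T & @run c (start c) M T' M' r.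

Lemma runs_le c M T T' M' r : T <= T' -> runs c M T M' r -> runs c M T' M' r.
Proof. by move=> TT' [T1 T1T H]; exists T1; rewrite ?(leq_trans T1T). Qed.

Lemma memory_ext (M M' : memory) : head M =1 head M' -> (forall i, tape M i =1 tape M' i) -> M = M'.
Proof.
case: M M' => h t [h' t'] /= hE tE; congr Memory.
  exact: functional_extensionality.
by do 2!apply: functional_extensionality => ?; apply: tE.
Qed.

Lemma runs_ret r M : runs (Ret r) M 1 M r.
Proof.
exists 1 => //.
have H := @RunExit (Ret r) tt M r _ erefl.
have E : act (fun i => (reads M i, MoveN)) M = M; last by rewrite /= E in H.
by apply: memory_ext => //= i p; rewrite /reads ffunE; case: eqP => [->|].
Qed.

Lemma runs_test i s M :
  runs (Test i s) M 1 M (Some (tape M (inord i) (head M (inord i)) == s)).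
Proof.
exists 1 => //.
have H := @RunExit (Test i s) tt M _ _ erefl.
have E : act (fun i => (reads M i, MoveN)) M = M.
  by apply: memory_ext => //= j p; rewrite /reads ffunE; case: eqP => [->|].
by rewrite /= E ffunE in H.
Qed.

Lemma runs_act wr mv M :
  runs (Act wr mv) M 1
    (Memory (fun i => move_head (mv i) (head M i))
         (fun i p => if p == head M i then odflt (tape M i p) (wr i) else tape M i p))
    None.
Proof.
exists 1 => //.
have H := @RunExit (Act wr mv) tt M _ _ erefl.
rewrite /= in H; congr run : H; apply: memory_ext => //= i p.
by rewrite /reads ffunE; case: eqP => [->|].
Qed.

Lemma runs_if c0 c1 c2 M T M1 r0 T' M2 r :
  runs c0 M T M1 r0 ->
  runs (if r0 is Some true then c1 else c2) M1 T' M2 r ->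
  runs (If c0 c1 c2) M (T + T') M2 r.
Proof.
case=> t tT H0 [t' tT' H1].
exists (t + t'); first exact: leq_add.
rewrite /=; move: (start c0) H0 => s H0.
(* The states of each branch form a summand of the state space, so a run of a branch is also a run
   of the whole command. *)
have K1 (s1 : st c1) N S N' r' : run s1 N S N' r' ->
    @run (If c0 c1 c2) (inr (inl s1)) N S N' r'.
  elim=> {s1 N S N' r'} [s1 N r' a E|s1 N s' a S N' r' E _ IH].
    by apply: RunExit; rewrite /= E.
  by apply: RunStep IH; rewrite /= E.
have K2 (s1 : st c2) N S N' r' : run s1 N S N' r' ->
    @run (If c0 c1 c2) (inr (inr s1)) N S N' r'.
  elim=> {s1 N S N' r'} [s1 N r' a E|s1 N s' a S N' r' E _ IH].
    by apply: RunExit; rewrite /= E.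
  by apply: RunStep IH; rewrite /= E.
elim: H0 H1 => {s M t M1 r0 tT} [s M r0 a E|s M s' a t M1 r0 E _ IH] H1.
  case: r0 E H1 => [[]|] E H1; apply: RunStep; rewrite /= ?E //.
  - exact: K1.
  - exact: K2.
  - exact: K2.
by apply: RunStep (IH H1); rewrite /= E.
Qed.

Lemma runs_loop_exit c M T M' b :
  runs c M T M' (Some b) -> runs (Loop c) M T M' (Some b).
Proof.
case=> t tT H; exists t => //=; move: (start c) H => s.
move Er : (Some b) => r H.
elim: H Er => {s M t M' r tT} [s M r0 a E|s M s' a t M1 r0 E _ IH] Er.
  by apply: RunExit; rewrite /= E -Er.
by apply: RunStep (IH Er); rewrite /= E.
Qed.

Lemma runs_loop_next c M T M1 T' M' r :
  runs c M T M1 None -> runs (Loop c) M1 T' M' r ->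
  runs (Loop c) M (T + T') M' r.
Proof.
case=> t tT H [t' tT' H']; exists (t + t'); first exact: leq_add.
rewrite /= in H' *; move: (start c) H => s.
move Er : None => r0 H.
elim: H H' Er => {s M t M1 r0 tT} [s M r0 a E|s M s' a t M1 r0 E _ IH] H' Er.
  by apply: RunStep H'; rewrite /= E -Er.
by apply: RunStep (IH H' Er); rewrite /= E.
Qed.

(** [M j] is the memory before round [j], and [T] bounds every round including the one that exits;
    hence the factor [q.+1]. *)
Lemma runs_loop c (M : nat -> memory) q T M' b :
  (forall j, j < q -> runs c (M j) T (M j.+1) None) ->
  runs c (M q) T M' (Some b) ->
  runs (Loop c) (M 0) (q.+1 * T) M' (Some b).
Proof.
elim: q M => [|q IH] M Hn He; first by rewrite mul1n; apply: runs_loop_exit.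
rewrite mulSn; apply: runs_loop_next (Hn 0 _) _ => //.
by apply: (IH (fun j => M j.+1)) => // j jq; apply: Hn.
Qed.

Definition Seq c1 c2 := If c1 c2 c2.

Lemma runs_seq c1 c2 M T M1 r0 T' M2 r :
  runs c1 M T M1 r0 -> runs c2 M1 T' M2 r -> runs (Seq c1 c2) M (T + T') M2 r.
Proof. by move=> H1 H2; apply: runs_if H1 _; case: r0 => [[]|]. Qed.

End Programs.

(** * Evaluation of first-order conditions on a graph *)

Definition pbound (f : nat -> nat) :=
  exists p : {poly nat}, forall N, f N <= (p.[N])%R.

Lemma pbound_const c : pbound (fun=> c).
Proof. by exists (c%:P)%R => N; rewrite hornerC. Qed.

Lemma pbound_id : pbound id.
Proof. by exists ('X)%R => N; rewrite hornerX. Qed.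

Lemma pboundD f g : pbound f -> pbound g -> pbound (fun N => f N + g N).
Proof. by case=> p Hp [q Hq]; exists (p + q)%R => N; rewrite hornerD leq_add. Qed.

Lemma pboundM f g : pbound f -> pbound g -> pbound (fun N => f N * g N).
Proof. by case=> p Hp [q Hq]; exists (p * q)%R => N; rewrite hornerM leq_mul. Qed.

Lemma pboundS f : pbound f -> pbound (fun N => (f N).+1).
Proof.
by move=> /(pboundD (pbound_const 1)) [p Hp]; exists p => N; rewrite -add1n.
Qed.

(** The coefficients are natural numbers, so evaluation is monotone. This turns a bound in the
    number of vertices into one in the length of the input. *)
Lemma horner_leq (p : {poly nat}) a b : a <= b -> ((p.[a])%R : nat) <= (p.[b])%R.
Proof.
move=> ab; rewrite /horner.
elim: (polyseq p) => //= c s IH.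
by apply: leq_add => //; apply: leq_mul.
Qed.

Definition upd T (e : nat -> T) x v := fun i => if i == x then v else e i.

(** Truncated subtraction matches a head that stays on cell 0 under left moves. *)
Definition shift d q x := match d with MoveL => x - q | MoveN => x | MoveR => x + q end.

Lemma shift0 d x : shift d 0 x = x.
Proof. by case: d => /=; lia. Qed.

Lemma shiftS d q x : move_head d (shift d q x) = shift d q.+1 x.
Proof. by case: d => /=; lia. Qed.

Lemma shiftD d q r x : shift d q (shift d r x) = shift d (r + q) x.
Proof. by case: d => /=; lia. Qed.

(** * Instances on numbered vertices and their input words *)

Record inst := Inst {
  isz : nat; ik : nat; iadj : nat -> nat -> bool; isz_gt0 : 0 < isz }.

Definition word I :=
  nseq (isz I) true ++ false :: nseq (ik I) true ++ false ::
  [seq iadj I u v | u <- iota 0 (isz I), v <- iota 0 (isz I)].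

(** The cell of the first matrix entry: the word starts in cell 1, and its unary part with both
    separators has length [isz I + ik I + 2]. *)
Definition home I := isz I + ik I + 3.

Lemma nth_allpairs_iota T x0 (f : nat -> nat -> T) a b p i j : i < b -> j < p ->
  nth x0 [seq f u v | u <- iota a b, v <- iota 0 p] (i * p + j) = f (a + i) j.
Proof.
move=> ib jp; elim: b a i ib => //= b IH a [|i] ib.
  by rewrite nth_cat size_map size_iota jp (nth_map 0) ?size_iota // nth_iota // addn0.
rewrite nth_cat size_map size_iota ifF; last by nia.
by rewrite (_ : i.+1 * p + j - p = i * p + j) ?IH ?addSnnS //; nia.
Qed.

Lemma nth_word I p : nth false (word I) p =
  if p < isz I then true else if p == isz I then false else
  if p <= isz I + ik I then true else if p == (isz I + ik I).+1 then false else
  nth false [seq iadj I u v | u <- iota 0 (isz I), v <- iota 0 (isz I)]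
     (p - (isz I + ik I + 2)).
Proof.
rewrite /word nth_cat size_nseq nth_nseq; case: ltnP => // H1.
case: eqP => [->|H2]; first by rewrite subnn.
rewrite (_ : p - isz I = (p - (isz I).+1).+1) /=; last by lia.
rewrite nth_cat size_nseq nth_nseq; case: (leqP p (isz I + ik I)) => H3.
  have -> : p - (isz I).+1 < ik I by lia.
  by [].
rewrite ifF; last by lia.
case: eqP => H4; first by rewrite H4 (_ : (isz I + ik I).+1 - (isz I).+1 - ik I = 0) //; lia.
by rewrite (_ : p - (isz I).+1 - ik I = (p - (isz I + ik I + 2)).+1) //; lia.
Qed.

Lemma nth_word_adj I i j : i < isz I -> j < isz I ->
  nth false (word I) (home I + i * isz I + j).-1 = iadj I i j.
Proof.
move=> iI jI; rewrite nth_word /home.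
do 4 (rewrite ifF; last by nia).
by rewrite -(nth_allpairs_iota false (iadj I) 0 iI jI); congr nth; lia.
Qed.

Lemma size_word I : size (word I) = isz I + ik I + 2 + isz I * isz I.
Proof.
by rewrite /word size_cat /= size_cat /= !size_nseq size_allpairs !size_iota; lia.
Qed.

(** * Commands on numbers stored as head positions *)

Section Commands.
Variable m : nat.
Notation sym := (tape_symbol bool).
Notation runs := (@runs m).

Definition left_mark : sym := Some (inr false).
Definition right_mark : sym := Some (inr true).
Definition true_sym : sym := Some (inl true).

(* Numbers are stored as head positions; the marks on cells [0] and [isz I] make the
   extreme values of a variable recognizable. *)
Definition cell I (i p : nat) : sym :=
  if p == 0 then left_mark else
  if i == 0 then nth None [seq Some (inl b) | b <- word I] p.-1 else
  if p == isz I then right_mark else None.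

Definition layout (T : nat -> nat -> sym) (e : nat -> nat) : memory m :=
  Memory (fun i => e i) (fun i => T i).
Notation conf I := (layout (cell I)).

Lemma layout_ext T e e' : e =1 e' -> layout T e = layout T e'.
Proof. by move=> E; apply: memory_ext => // i /=; apply: E. Qed.

Lemma runs_testS T e i s : i <= m ->
  runs (Test i s) (layout T e) 1 (layout T e) (Some (T i (e i) == s)).
Proof. by move=> im; have := runs_test i s (layout T e); rewrite /= inordK. Qed.

Lemma runs_testL I e i : 0 < i <= m ->
  runs (Test i left_mark) (conf I e) 1 (conf I e) (Some (e i == 0)).
Proof.
case/andP=> i0 im; have := runs_testS (cell I) e left_mark im.
by rewrite /cell (gtn_eqF i0); case: (e i =P 0) => // _; case: ifP.
Qed.

Lemma runs_testR I e i : 0 < i <= m ->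
  runs (Test i right_mark) (conf I e) 1 (conf I e) (Some (e i == isz I)).
Proof.
case/andP=> i0 im; have := runs_testS (cell I) e right_mark im.
rewrite /cell (gtn_eqF i0); case: (e i =P 0) => [->|_]; last by case: ifP.
(* Positivity of [isz I] keeps the right mark apart from cell 0. *)
by rewrite (ltn_eqF (isz_gt0 I)).
Qed.

Lemma runs_test_adj I e x y : x < isz I -> y < isz I ->
  e 0 = home I + x * isz I + y ->
  runs (Test 0 true_sym) (conf I e) 1 (conf I e) (Some (iadj I x y)).
Proof.
move=> xI yI E; have := runs_testS (cell I) e true_sym (leq0n m).
rewrite /cell E eqxx ifF; last by rewrite /home; lia.
rewrite (nth_map false) ?nth_word_adj //; first by case: iadj.
by rewrite size_word /home; nia.
Qed.

Definition Mv (a : nat -> move) := Act (fun=> None) a.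
Definition stay : nat -> move := fun=> MoveN.

Lemma runs_mv T e a e' : (fun i => move_head (a i) (e i)) =1 e' ->
  runs (Mv a) (layout T e) 1 (layout T e') None.
Proof.
move=> E; have := runs_act (fun=> None) a (layout T e); congr runs.
by apply: memory_ext => [i|i p] /=; [apply: E|case: ifP].
Qed.

Definition Until i s a := Loop (If (Test i s) (Ret (Some true)) (Mv a)).

Lemma runs_until T e i s a q e' : i <= m ->
  (forall j, j < q -> T i (shift (a i) j (e i)) != s) ->
  T i (shift (a i) q (e i)) = s ->
  (fun t => shift (a t) q (e t)) =1 e' ->
  runs (Until i s a) (layout T e) (q.+1 * 2) (layout T e') (Some true).
Proof.
move=> im Hn He E; rewrite -(layout_ext T E).
have E0 : e =1 (fun t => shift (a t) 0 (e t)) by move=> t; rewrite shift0.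
rewrite {1}(layout_ext T E0).
apply: (runs_loop (M := fun j => layout T (fun t => shift (a t) j (e t)))) => [j jq|].
  apply: (runs_if (T := 1) (T' := 1)); first exact: runs_testS.
  rewrite (negbTE (Hn j jq)).
  by apply: runs_mv => t; rewrite shiftS.
apply: (runs_if (T := 1) (T' := 1)); first exact: runs_testS.
by rewrite He eqxx; apply: runs_ret.
Qed.

(** While head [i] returns to cell 0, the other heads follow [a]; this adds the value of variable
    [i] to other heads or subtracts it from them. *)
Definition Down i a := Until i left_mark (upd a i MoveL).
Definition Up i a := Until i right_mark (upd a i MoveR).

Lemma runs_down I e i a e' : 0 < i <= m -> e i <= isz I ->
  (fun t => if t == i then 0 else shift (a t) (e i) (e t)) =1 e' ->
  runs (Down i a) (conf I e) ((isz I).+1 * 2) (conf I e') (Some true).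
Proof.
case/andP=> i0 im ei E; apply: (@runs_le _ _ _ ((e i).+1 * 2)); first by lia.
apply: runs_until => // [j jq||t]; last first.
- by rewrite -E /upd; case: eqP => // ->; rewrite /= subnn.
- by rewrite /upd eqxx /= subnn.
rewrite /upd eqxx /=; by rewrite /cell (gtn_eqF i0) subn_eq0 leqNgt jq /=; case: (_ =P isz I).
Qed.

Lemma runs_up I e i a e' : 0 < i <= m -> e i = 0 ->
  (fun t => if t == i then isz I else shift (a t) (isz I) (e t)) =1 e' ->
  runs (Up i a) (conf I e) ((isz I).+1 * 2) (conf I e') (Some true).
Proof.
case/andP=> i0 im ei E.
apply: runs_until => // [j jq||t]; last by rewrite -E /upd; case: eqP => // ->; rewrite /= ei.
  rewrite /upd eqxx /= ei /cell add0n (gtn_eqF i0).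
  by case: (j =P 0) => // _; rewrite (ltn_eqF jq).
by rewrite /upd eqxx /= ei /cell add0n (gtn_eqF i0) eqxx (gtn_eqF (isz_gt0 I)).
Qed.

Ltac by_upd := rewrite /upd /stay; repeat (case: eqP => ?); subst; rewrite /= ?shift0 ?shiftD;
  first [done | lia | congruence | by f_equal; lia].

(* Tape 0 is the input, tape 1 holds [k], tapes 2 and 3 are scratch. *)
Definition Walk d x y :=
  Seq (Down x (upd stay 2 MoveR))
 (Seq (Loop (If (Test 2 left_mark) (Ret (Some true))
         (Seq (Up 3 (upd stay 0 d)) (Seq (Down 3 stay)
              (Mv (upd (upd stay 2 MoveL) x MoveR))))))
 (Seq (Down y (upd (upd stay 2 MoveR) 0 d))
      (Down 2 (upd stay y MoveR)))).

(** The value of [x] is first moved to tape 2. Each unit carried back to [x] is accompanied by one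
    pass of head 3 over [isz I] cells, during which head 0 crosses one matrix row. Then [y] goes to
    tape 2 and back, head 0 moving along on the way there. As [x] is restored before [y] is read,
    the two may coincide. *)
Lemma runs_walk I e d x y : 4 <= x <= m -> 4 <= y <= m ->
  e x <= isz I -> e y <= isz I -> e 2 = 0 -> e 3 = 0 ->
  runs (Walk d x y) (conf I e) ((isz I).+1 * 6 + (isz I).+1 * ((isz I).+1 * 4 + 2))
    (conf I (upd e 0 (shift d (e x * isz I + e y) (e 0)))) (Some true).
Proof.
move=> /andP[x4 xm] /andP[y4 ym] ex ey e2 e3; set n := isz I.
pose e1 j := upd (upd (upd e x j) 2 (e x - j)) 0 (shift d (j * n) (e 0)).
have H1 : runs (Down x (upd stay 2 MoveR)) (conf I e) (n.+1 * 2) (conf I (e1 0)) (Some true).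
  apply: runs_down => //; first by lia.
  by move=> t; rewrite /e1; by_upd.
have H2 : runs (Loop (If (Test 2 left_mark) (Ret (Some true))
         (Seq (Up 3 (upd stay 0 d)) (Seq (Down 3 stay)
              (Mv (upd (upd stay 2 MoveL) x MoveR))))))
      (conf I (e1 0)) (n.+1 * (n.+1 * 4 + 2)) (conf I (e1 (e x))) (Some true).
  apply: (@runs_le _ _ _ ((e x).+1 * (n.+1 * 4 + 2))); first by nia.
  apply: (runs_loop (M := fun j => conf I (e1 j))) => [j jx|].
    rewrite (_ : n.+1 * 4 + 2 = 1 + (1 + n.+1 * 4)); last by lia.
    apply: runs_if; first by apply: runs_testL; lia.
    rewrite {1}/e1 {1}/upd /= {1}/upd /= ifF; last by lia.
    rewrite (_ : 1 + n.+1 * 4 = n.+1 * 2 + (n.+1 * 2 + 1)); last by lia.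
    pose e3' := upd (upd (e1 j) 3 n) 0 (shift d (j.+1 * n) (e 0)).
    apply: (runs_seq (M1 := conf I e3')).
      apply: runs_up; first (by lia); first by rewrite /e1 /upd /= ifF //; lia.
      by move=> t; rewrite /e3' /e1; by_upd.
    apply: (runs_seq (M1 := conf I (upd (e1 j) 0 (shift d (j.+1 * n) (e 0))))).
      apply: runs_down; first (by lia); first by rewrite /e3' /upd /=.
      by move=> t; rewrite /e3' /e1; by_upd.
    by apply: runs_mv => t; rewrite /e1; by_upd.
  apply: (@runs_le _ _ _ (1 + 1)); first by nia.
  apply: runs_if; first by apply: runs_testL; lia.
  by rewrite {1}/e1 {1}/upd /= {1}/upd /= subnn; apply: runs_ret.
have H3 : runs (Down y (upd (upd stay 2 MoveR) 0 d)) (conf I (e1 (e x))) (n.+1 * 2)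
   (conf I (upd (upd (upd e 0 (shift d (e x * n + e y) (e 0))) 2 (e y)) y 0)) (Some true).
  have E : e1 (e x) y = e y.
    by rewrite /e1; by_upd.
  apply: runs_down; rewrite ?E //; first by lia.
  by move=> t; rewrite /e1; by_upd.
have H4 : runs (Down 2 (upd stay y MoveR))
   (conf I (upd (upd (upd e 0 (shift d (e x * n + e y) (e 0))) 2 (e y)) y 0)) (n.+1 * 2)
   (conf I (upd e 0 (shift d (e x * n + e y) (e 0)))) (Some true).
  have E : upd (upd (upd e 0 (shift d (e x * n + e y) (e 0))) 2 (e y)) y 0 2 = e y.
    by rewrite /upd ifF //; lia.
  apply: runs_down; rewrite ?E //; first by lia.
  by move=> t; by_upd.
apply: runs_le (runs_seq H1 (runs_seq H2 (runs_seq H3 H4))); lia.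
Qed.

(* Only the tapes [4, ..., d.-1] hold bound variables; the head of tape 1 is left free. *)
Definition good d I (e : nat -> nat) :=
  [/\ e 0 = home I, e 2 = 0, e 3 = 0, forall i, 4 <= i -> e i < isz I
    & forall i, d <= i -> e i = 0].

Lemma good_upd d I e x : 4 <= d -> x < isz I -> good d I e -> good d.+1 I (upd e d x).
Proof.
move=> d4 xI [e0 e2 e3 ei ed]; split; rewrite /upd; try by rewrite ifF //; lia.
  by move=> i i4; case: eqP => // _; apply: ei.
by move=> i di; rewrite ifF ?ed //; lia.
Qed.

Definition decides d (c : cmd) (phi : inst -> (nat -> nat) -> bool) :=
  exists2 f, pbound f & forall I e, good d I e ->
    runs c (conf I e) (f (isz I)) (conf I e) (Some (phi I e)).

Lemma decides_ext d c phi psi : (forall I e, good d I e -> phi I e = psi I e) ->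
  decides d c phi -> decides d c psi.
Proof. by move=> E [f pf H]; exists f => // I e g; rewrite -E //; apply: H. Qed.

Definition Fin b := Ret (Some b).

(** Clean-up by [c'] after [c]; the two copies of [c'] let the control state remember the answer of
    [c] meanwhile. *)
Definition Finally c c' := If c (Seq c' (Fin true)) (Seq c' (Fin false)).

Lemma runs_finally c c' M T M1 b T' M2 r :
  runs c M T M1 (Some b) -> runs c' M1 T' M2 r ->
  runs (Finally c c') M (T + (T' + 1)) M2 (Some b).
Proof.
move=> H1 H2; apply: runs_if H1 _.
by case: b; apply: runs_seq H2 _; apply: runs_ret.
Qed.

Definition Adj x y :=
  Seq (Walk MoveR x y) (Finally (Test 0 true_sym) (Walk MoveL x y)).

Ltac pb := repeat first [assumption | exact: pbound_const | exact: pbound_id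
  | apply: pboundS | apply: pboundD | apply: pboundM].

Lemma decides_adj d x y : 4 <= x <= m -> 4 <= y <= m ->
  decides d (Adj x y) (fun I e => iadj I (e x) (e y)).
Proof.
move=> Hx Hy; pose w n := n.+1 * 6 + n.+1 * (n.+1 * 4 + 2).
exists (fun n => w n + (1 + (w n + 1))); first by rewrite /w; pb.
move=> I e [e0 e2 e3 ei ed].
have xI := ei x; have yI := ei y.
apply: runs_seq; first by apply: runs_walk => //; lia.
apply: runs_finally.
  by apply: runs_test_adj; [apply: xI | apply: yI | rewrite /upd /= e0]; lia.
set e' := upd e 0 _.
have E'x : e' x = e x by rewrite /e'; by_upd.
have E'y : e' y = e y by rewrite /e'; by_upd.
rewrite [conf I e](@layout_ext (cell I) _ (upd e' 0 (shift MoveL (e' x * isz I + e' y) (e' 0)))).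
  by apply: runs_walk => //; rewrite ?E'x ?E'y //; apply: ltnW; [apply: xI|apply: yI]; lia.
by move=> t; rewrite E'x E'y /e'; by_upd.
Qed.

(** Both variables decrease in step while tape 2 counts the rounds. Since [y] is tested for 0 first,
    equality yields false. Tape 2 then gives the lost units back. *)
Definition Lt x y :=
  Finally
    (Loop (If (Test y left_mark) (Fin false) (If (Test x left_mark) (Fin true)
       (Mv (upd (upd (upd stay 2 MoveR) x MoveL) y MoveL)))))
    (Down 2 (upd (upd stay x MoveR) y MoveR)).

Lemma decides_lt d x y : 4 <= x <= m -> 4 <= y <= m -> x != y ->
  decides d (Lt x y) (fun I e => e x < e y).
Proof.
move=> Hx Hy xy; exists (fun n => n.+1 * 3 + (n.+1 * 2 + 1)); first by pb.
move=> I e [e0 e2 e3 ei ed].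
have xI := ei x; have yI := ei y.
pose e' j := upd (upd (upd e x (e x - j)) y (e y - j)) 2 j.
have E'2 j : e' j 2 = j by rewrite /e' /upd.
have E'x j : e' j x = e x - j by rewrite /e' /upd ifF ?(negbTE xy) ?eqxx; lia.
have E'y j : e' j y = e y - j by rewrite /e' /upd ifF ?eqxx; lia.
apply: (runs_finally (M1 := conf I (e' (minn (e x) (e y))))).
  apply: (@runs_le _ _ _ ((minn (e x) (e y)).+1 * 3)); first by lia.
  rewrite (_ : conf I e = conf I (e' 0)); last first.
    by apply: layout_ext => t; rewrite /e' /upd; do !case: eqP => [->|]; lia.
  apply: (runs_loop (M := fun j => conf I (e' j))) => [j jq|].
    apply: (@runs_if _ _ _ _ _ 1 _ _ 2); first by apply: runs_testL; lia.
    rewrite E'y ifF; last by lia.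
    apply: (@runs_if _ _ _ _ _ 1 _ _ 1); first by apply: runs_testL; lia.
    rewrite E'x ifF; last by lia.
    by apply: runs_mv => t; rewrite /e'; by_upd.
  apply: (@runs_if _ _ _ _ _ 1 _ _ 2); first by apply: runs_testL; lia.
  rewrite E'y; case: eqP => H.
    rewrite (_ : (e x < e y) = false); last by lia.
    by apply: runs_le (runs_ret _ _).
  apply: (@runs_if _ _ _ _ _ 1 _ _ 1); first by apply: runs_testL; lia.
  rewrite E'x ifT; last by lia.
  rewrite (_ : (e x < e y) = true); last by lia.
  exact: runs_ret.
apply: runs_down; rewrite ?E'2; try lia.
by move=> t; rewrite /e' /upd; do !case: eqP => [?|?] //=; subst; lia.
Qed.

Lemma decides_fin d b : decides d (Fin b) (fun _ _ => b).
Proof. by exists (fun=> 1) => [|I e _]; [pb|apply: runs_ret]. Qed.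

Lemma decides_if d c0 c1 c2 p0 p1 p2 :
  decides d c0 p0 -> decides d c1 p1 -> decides d c2 p2 ->
  decides d (If c0 c1 c2) (fun I e => if p0 I e then p1 I e else p2 I e).
Proof.
move=> [f0 b0 H0] [f1 b1 H1] [f2 b2 H2].
exists (fun n => f0 n + (f1 n + f2 n)) => [|I e g]; first by pb.
apply: runs_if (H0 I e g) _; case: (p0 I e).
  by apply: runs_le (H1 I e g); lia.
by apply: runs_le (H2 I e g); lia.
Qed.

Definition Not c := If c (Fin false) (Fin true).
Definition And c c' := If c c' (Fin false).
Definition Or c c' := If c (Fin true) c'.

Lemma decides_not d c p : decides d c p -> decides d (Not c) (fun I e => ~~ p I e).
Proof.
move=> H; have := decides_if H (decides_fin d false) (decides_fin d true).
by apply: decides_ext => I e _; case: ifP.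
Qed.

Lemma decides_and d c c' p p' : decides d c p -> decides d c' p' ->
  decides d (And c c') (fun I e => p I e && p' I e).
Proof. by move=> H H'; apply: decides_if H H' (decides_fin d false). Qed.

Lemma decides_or d c c' p p' : decides d c p -> decides d c' p' ->
  decides d (Or c c') (fun I e => p I e || p' I e).
Proof. by move=> H H'; apply: decides_if H (decides_fin d true) H'. Qed.

Definition Ex d c :=
  Finally
    (Loop (If (Test d right_mark) (Fin false)
       (If c (Fin true) (Mv (upd stay d MoveR)))))
    (Down d stay).

Lemma decides_ex d c phi : 4 <= d <= m -> decides d.+1 c phi ->
  decides d (Ex d c)
    (fun I e => has (fun x => phi I (upd e d x)) (iota 0 (isz I))).
Proof.
case/andP=> d4 dm [f pf H].
exists (fun n => n.+1 * (f n + 2) + (n.+1 * 2 + 1)) => [|I e g]; first by pb.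
(* [q] is the first witness, or [isz I] if there is none; it is the number of rounds before the loop
   exits. *)
set P := fun x => _; set n := isz I; set q := find P (iota 0 n).
have qn : q <= n by rewrite -[n](size_iota 0) find_size.
have nthP j : j < n -> nth 0 (iota 0 n) j = j by move=> jn; rewrite nth_iota.
have Hc j : j < n -> runs c (conf I (upd e d j)) (f n) (conf I (upd e d j)) (Some (P j)).
  by move=> jn; apply: H; apply: good_upd.
have updE j : upd e d j d = j by rewrite /upd eqxx.
apply: (runs_finally (M1 := conf I (upd e d q))); last first.
  apply: runs_down; rewrite ?updE //; first by lia.
  case: g => _ _ _ _ ed.
  by move=> t; rewrite /upd; case: eqP => // ->; rewrite ed.
rewrite has_find size_iota -/q.
apply: (@runs_le _ _ _ (q.+1 * (f n + 2))); first by nia.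
rewrite (_ : conf I e = conf I (upd e d 0)); last first.
  case: g => _ _ _ _ ed.
  by apply: layout_ext => t; rewrite /upd; case: eqP => // ->; rewrite ed.
apply: (runs_loop (M := fun j => conf I (upd e d j))) => [j jq|].
  rewrite (_ : f n + 2 = 1 + (f n + 1)); last by lia.
  apply: runs_if; first by apply: runs_testR; lia.
  rewrite updE ifF; last by lia.
  apply: runs_if; first by apply: Hc; lia.
  have -> : P j = false by rewrite -[j]nthP ?before_find //; lia.
  by apply: runs_mv => t; by_upd.
rewrite (_ : f n + 2 = 1 + (f n + 1)); last by lia.
apply: runs_if; first by apply: runs_testR; lia.
rewrite updE -/n; case: eqP => [->|/eqP H1].
  by rewrite ltnn; apply: runs_le (runs_ret _ _); lia.
have q1 : q < n by rewrite ltn_neqAle H1.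
rewrite q1; apply: runs_if (Hc q q1) _.
have -> : P q by rewrite -[q]nthP // nth_find // has_find size_iota.
exact: runs_ret.
Qed.

Definition All d c := Not (Ex d (Not c)).

Lemma decides_all d c phi : 4 <= d <= m -> decides d.+1 c phi ->
  decides d (All d c)
    (fun I e => all (fun x => phi I (upd e d x)) (iota 0 (isz I))).
Proof.
move=> Hd /decides_not /(decides_ex Hd) /decides_not; apply: decides_ext => I e _.
by rewrite -all_predC; apply: eq_all => x /=; rewrite negbK.
Qed.

(** Here [j] is a constant of the program, unrolled into its states, and not a number on a tape. *)
Fixpoint Kge j :=
  if j is j'.+1 then
    If (Test 1 left_mark) (Fin false)
      (Seq (Mv (upd stay 1 MoveL)) (Finally (Kge j') (Mv (upd stay 1 MoveR))))
  else Fin true.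

Lemma decides_kge d j : 1 <= m -> decides d (Kge j) (fun I e => j <= e 1).
Proof.
(* The hypothesis [good] is dropped for the induction, since the recursive call runs with head 1
   lowered. *)
move=> m1; suff [f pf H] : exists2 f, pbound f & forall I e,
    runs (Kge j) (conf I e) (f (isz I)) (conf I e) (Some (j <= e 1)).
  by exists f.
elim: j => [|j [f pf H]]; first by exists (fun=> 1) => [|I e]; [pb|apply: runs_ret].
exists (fun n => 1 + (1 + (f n + (1 + 1)))) => [|I e]; first by pb.
apply: runs_if; first by apply: runs_testL; lia.
case: eqP => e1.
  by rewrite e1; apply: runs_le (runs_ret _ _); lia.
apply: runs_seq; first exact: (runs_mv _ (frefl _)).
set e' := fun t => _.
have -> : (j < e 1) = (j <= e' 1) by rewrite /e' /upd /=; lia.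
apply: runs_finally; first exact: H.
by apply: runs_mv => t; rewrite /e'; by_upd.
Qed.

(* Tape 1 is started at [k + 1], so that saturation at cell 0 means [k < 2 * count]. *)
Definition Count2 c :=
  Seq (Mv (upd stay 1 MoveR))
 (Seq (Loop (If (Test 4 right_mark) (Fin true)
         (If c (Seq (Mv (upd stay 1 MoveL))
                    (Mv (upd (upd stay 1 MoveL) 4 MoveR)))
               (Mv (upd stay 4 MoveR)))))
 (If (Test 1 left_mark) (Fin false) (Fin true))).

(** Head 1 is lowered while [c] runs, so [phi] may depend on variable 4 only. The final memory is
    left open: this command comes last and need not restore [k]. *)
Lemma runs_count2 c phi : 4 <= m ->
  decides 5 c phi -> (forall I e e', e 4 = e' 4 -> phi I e = phi I e') ->
  exists2 f, pbound f & forall I e, good 4 I e -> exists M,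
    runs (Count2 c) (conf I e) (f (isz I)) M
      (Some ((count (fun x => phi I (upd e 4 x)) (iota 0 (isz I))).*2 <= e 1)).
Proof.
move=> m4 [f pf H] ph.
exists (fun n => 1 + (n.+1 * (1 + (f n + 2)) + (1 + 1))) => [|I e g]; first by pb.
pose P x := phi I (upd e 4 x); set n := isz I.
rewrite -[X in count X]/P.
pose e' j := upd (upd e 4 j) 1 ((e 1).+1 - (count P (iota 0 j)).*2).
have e'4 j : e' j 4 = j by rewrite /e' /upd.
have e'1 j : e' j 1 = (e 1).+1 - (count P (iota 0 j)).*2 by rewrite /e' /upd.
have Hc j : j < n -> runs c (conf I (e' j)) (f n) (conf I (e' j)) (Some (P j)).
  move=> jn; have -> : P j = phi I (e' j) by apply: ph; rewrite e'4 /upd eqxx.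
  apply: H; have [g0 g2 g3 g4 g5] := good_upd (isT : 4 <= 4) jn g.
  by split=> // i Hi; rewrite /e' {1}/upd ifF; [apply: g4| lia|apply: g5|lia].
exists (conf I (e' n)).
apply: (runs_seq (M1 := conf I (e' 0)) (r0 := None)).
  case: g => _ _ _ _ /(_ 4 isT) ed.
  by apply: runs_mv => t; rewrite /e' [iota _ _]/= [count _ _]/=; by_upd.
apply: (runs_seq (M1 := conf I (e' n)) (r0 := Some true)); last first.
  apply: runs_if; first by apply: runs_testL; lia.
  rewrite e'1 subn_eq0 leqNgt ltnS -/n; case: leqP => _; exact: runs_ret.
apply: (runs_loop (M := fun j => conf I (e' j))) => [j jn|]; last first.
  apply: runs_if; first by apply: runs_testR; lia.
  by rewrite e'4 eqxx; apply: runs_le (runs_ret _ _); lia.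
apply: runs_if; first by apply: runs_testR; lia.
rewrite e'4 (ltn_eqF jn); apply: runs_if (Hc j jn) _.
have E : count P (iota 0 j.+1) = count P (iota 0 j) + P j.
  by rewrite -addn1 iotaD count_cat /= add0n addn0.
case: ifP => Pj; rewrite Pj in E.
  apply: (@runs_seq _ _ _ _ 1 _ _ 1); first exact: (runs_mv _ (frefl _)).
  set e'' := fun t => _.
  by apply: runs_mv => t; rewrite /e'' /e' E; by_upd.
apply: (@runs_le _ _ _ 1) => //.
by apply: runs_mv => t; rewrite /e' E; by_upd.
Qed.

(** After the first action head 0 is one cell ahead of all others. When it meets the separator in
    cell [isz I + 1], the others stand on cell [isz I], where they write the right mark. They return
    to 0, head 1 then accompanies head 0 over the [k] ones, and a last move brings head 0 to
    [home I]. *)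
Definition Init :=
  Seq (Act (fun=> Some left_mark) (upd stay 0 MoveR))
 (Seq (Until 0 (Some (inl false)) (fun=> MoveR))
 (Seq (Act (fun i => if i == 0 then None else Some right_mark) (upd stay 0 MoveR))
 (Seq (Until 2 left_mark (upd (fun=> MoveL) 0 MoveN))
 (Seq (Until 0 (Some (inl false)) (upd (upd stay 0 MoveR) 1 MoveR))
      (Mv (upd stay 0 MoveR)))))).

(** Convertible with the tapes of [tm_init]. *)
Definition tape_init (w : seq bool) : 'I_m.+1 -> nat -> sym :=
  fun i => nth None (if i == ord0 then None :: [seq Some (inl b) | b <- w] else [::]).

Definition env_init I : nat -> nat := upd (upd (fun=> 0) 1 (ik I)) 0 (home I).

Lemma good_init d I : 4 <= d -> good d I (env_init I).
Proof.
by move=> d4; split=> // i Hi; rewrite /env_init; case: I => n k A n0 /=; by_upd.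
Qed.

Lemma runs_init I : 2 <= m -> ik I <= isz I ->
  runs Init (Memory (fun=> 0) (tape_init (word I))) ((isz I).+1 * 6 + 3)
    (conf I (env_init I)) None.
Proof.
move=> m2; set n := isz I; set k := ik I => kn.
pose T i p : sym := if p == 0 then left_mark else
  if i == 0 then nth None [seq Some (inl b) | b <- word I] p.-1 else None.
have n0 : 0 < n by apply: isz_gt0.
have TE p : p < size (word I) -> T 0 p.+1 = Some (inl (nth false (word I) p)).
  by move=> H; rewrite /T /= (nth_map false).
have cE p : p < size (word I) -> cell I 0 p.+1 = Some (inl (nth false (word I) p)).
  by move=> H; rewrite /cell /= (nth_map false).
have sw : n + k + 2 <= size (word I) by rewrite size_word leq_addr.
pose e1 := upd (fun=> 0) 0 1.
pose e2 := upd (fun=> n) 0 n.+1.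
pose e3 := upd (fun=> n) 0 n.+2.
pose e4 := upd (fun=> 0) 0 n.+2.
pose e5 := upd (upd (fun=> 0) 1 k) 0 (n.+2 + k).
have H1 : runs (Act (fun=> Some left_mark) (upd stay 0 MoveR))
   (Memory (fun=> 0) (tape_init (word I))) 1 (layout T e1) None.
  have := runs_act (fun=> Some left_mark) (upd stay 0 MoveR) (Memory (fun=> 0) (tape_init (word I))).
  congr runs; apply: memory_ext => [i|i p] /=; first by rewrite /e1; by_upd.
  rewrite /T /tape_init; case: p => [|p] //=.
  by case: eqP => [->|] //; case: eqP => [E []|_ _]; [apply: val_inj|rewrite nth_nil].
have H2 : runs (Until 0 (Some (inl false)) (fun=> MoveR)) (layout T e1) (n.+1 * 2)
   (layout T e2) (Some true).
  apply: runs_until => // [j jn||t]; last by rewrite /e1 /e2; by_upd.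
  - rewrite /e1 /upd /= add1n TE; last by lia.
    by rewrite nth_word jn.
  - rewrite /e1 /upd /= add1n TE; last by lia.
    by rewrite nth_word ltnn eqxx.
have H3 : runs (Act (fun i => if i == 0 then None else Some right_mark) (upd stay 0 MoveR))
   (layout T e2) 1 (conf I e3) None.
  have := runs_act (fun i => if i == 0 then None else Some right_mark) (upd stay 0 MoveR) (layout T e2).
  congr runs; apply: memory_ext => [i|i p] /=; first by rewrite /e2 /e3; by_upd.
  rewrite /T /cell /e2 /upd; case: (_ =P 0) => Ei; first by case: ifP.
  by rewrite -/n /=; case: (p =P n) => [->|_] //; rewrite (gtn_eqF n0).
have H4 : runs (Until 2 left_mark (upd (fun=> MoveL) 0 MoveN)) (conf I e3) (n.+1 * 2) (conf I e4) (Some true).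
  apply: runs_until => // [j jn||t]; last by rewrite /e3 /e4; by_upd.
  - by rewrite /e3 /upd /cell /= subn_eq0 leqNgt jn /=; case: (_ =P isz I).
  - by rewrite /e3 /upd /cell /= subnn.
have H5 : runs (Until 0 (Some (inl false)) (upd (upd stay 0 MoveR) 1 MoveR)) (conf I e4)
   (k.+1 * 2) (conf I e5) (Some true).
  apply: runs_until => // [j jn||t]; last by rewrite /e4 /e5; by_upd.
  - rewrite /e4 /upd /= addSn cE; last by lia.
    rewrite nth_word -/n -/k; do 2 (rewrite ifF; last by lia).
    by rewrite ifT //; lia.
  - rewrite /e4 /upd /= addSn cE; last by lia.
    rewrite nth_word -/n -/k; do 3 (rewrite ifF; last by lia).
    by rewrite ifT //; lia.
have H6 : runs (Mv (upd stay 0 MoveR)) (conf I e5) 1 (conf I (env_init I)) None.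
  by apply: runs_mv => t; rewrite /e5 /env_init /home -/n -/k; by_upd.
have := runs_seq H1 (runs_seq H2 (runs_seq H3 (runs_seq H4 (runs_seq H5 H6)))).
by apply: runs_le; lia.
Qed.

End Commands.

(** * Total domination in graphs without induced P4 + rK1 *)

(** Embeddings compose, unlike isomorphisms with induced subgraphs; the image of an embedding is the
    vertex set that [free_of] speaks of. *)
Definition embeds (H G : sgraph) :=
  exists2 f : H -> G, injective f & forall x y, adj (f x) (f y) = adj x y.

Lemma free_ofP (H G : sgraph) : free_of H G <-> ~ embeds H G.
Proof.
split=> [fr [f fI fA]|ne S [f [g fK gK] fA]].
  have fS x : f x \in [set f x | x in H] by apply: imset_f.
  pose h x : induced [set f x | x in H] := exist _ (f x) (fS x).
  have hI : injective h by move=> x y [] /fI.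
  have hK (y : induced [set f x | x in H]) : exists x, h x == y.
    by case: y => y yS; case/imsetP: (yS) => x _ E; exists x; apply/eqP/val_inj.
  pose g y := xchoose (hK y).
  have gK y : h (g y) = y by apply/eqP/(xchooseP (hK y)).
  apply: (fr [set f x | x in H]); exists g.
    by exists h => // x; apply: hI; rewrite gK.
  by move=> x y; rewrite -fA -{2}(gK x) -{2}(gK y).
apply: ne; exists (fun x => val (g x)).
  by move=> x y /val_inj E; rewrite -(gK x) -(gK y) E.
by move=> x y; rewrite -{2}(gK x) -{2}(gK y) fA.
Qed.

Lemma free_of_embeds (H H' G : sgraph) : embeds H H' -> free_of H G -> free_of H' G.
Proof.
move=> [f fI fA] /free_ofP nH; apply/free_ofP => -[g gI gA]; apply: nH.
by exists (g \o f) => [|x y]; [apply: inj_comp|rewrite /= gA].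
Qed.

Lemma embeds_dunion (H H' K : sgraph) : embeds H H' -> embeds (dunion H K) (dunion H' K).
Proof.
move=> [f fI fA]; exists (fun x => match x with inl a => inl (f a) | inr b => inr b end).
  by case=> [a|b] [a'|b'] // [] => [/fI|] ->.
by case=> [a|b] [a'|b'] /=.
Qed.

Lemma embeds_inr (H K : sgraph) : embeds K (dunion H K).
Proof. by exists inr => // x y []. Qed.

Lemma embeds_path s t : s <= t -> embeds (path_graph s) (path_graph t).
Proof.
move=> st; exists (widen_ord st) => // x y E.
by apply: val_inj; move/(congr1 val): E.
Qed.

Lemma embeds_edge_path : embeds (complete_graph 2) (path_graph 4).
Proof.
exists (widen_ord (isT : 2 <= 4)) => [x y E|]; first by apply: val_inj; move/(congr1 val): E.
by move=> [[|[|[]]] //= ?] [[|[|[]]] //= ?].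
Qed.

(** * Components of P4-free graphs, and graphs with an induced P4 *)

Section Graph.
Variable G : sgraph.
Implicit Types u v w x y : G.

Lemma adjN u v : adj u v -> u != v.
Proof. by move=> uv; apply/eqP => E; rewrite E adj_irr in uv. Qed.

Definition path4 (a b c d : G) :=
  [&& adj a b, adj b c, adj c d, ~~ adj a c, ~~ adj b d, ~~ adj a d & a != d].

(** Distance at most 2. Without induced P4 this is the relation of lying in one component. *)
Definition near (u v : G) := [|| u == v, adj u v | [exists w, adj u w && adj w v]].

Lemma near_refl u : near u u.
Proof. by rewrite /near eqxx. Qed.

Lemma near_sym u v : near u v = near v u.
Proof.
rewrite /near eq_sym adj_sym; do 2!congr orb.
by apply: eq_existsb => w; rewrite andbC (@adj_sym G w v) (@adj_sym G u w).
Qed.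

Lemma near_adj u v : adj u v -> near u v.
Proof. by move=> uv; rewrite /near uv orbT. Qed.

Section P4free.
Hypothesis noP4 : forall a b c d : G, ~~ path4 a b c d.

Lemma path4_chord (a b c d : G) : adj a b -> adj b c -> adj c d -> a != d ->
  [|| adj a c, adj b d | adj a d].
Proof.
move=> ab bc cd ad; apply: contraR (noP4 a b c d).
by rewrite !negb_or /path4 ab bc cd ad => /and3P[-> -> ->].
Qed.

(** A path [u], [w], [v], [z] with distinct ends has a chord, and every chord shortens it to length
    at most 2. *)
Lemma near_adj_trans u v z : near u v -> adj v z -> near u z.
Proof.
rewrite {1}/near => /or3P[/eqP->|uv|/existsP[w /andP[uw wv]]] vz.
- exact: near_adj.
- by rewrite /near; apply/or3P/Or33/existsP; exists v; rewrite uv.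
have [->|uz] := eqVneq u z; first exact: near_refl.
have /or3P[H|H|H] := path4_chord uw wv vz uz.
- by rewrite /near; apply/or3P/Or33/existsP; exists v; rewrite H.
- by rewrite /near; apply/or3P/Or33/existsP; exists w; rewrite uw.
- exact: near_adj.
Qed.

Lemma near_trans u v z : near u v -> near v z -> near u z.
Proof.
move=> uv /or3P[/eqP<-//|vz|/existsP[w /andP[vw wz]]].
  exact: near_adj_trans uv vz.
exact: near_adj_trans (near_adj_trans uv vw) wz.
Qed.

Let N u v := [set y | adj u y || adj v y].

(* An edge with a maximal joint neighbourhood dominates its component: otherwise some
   [x] in the joint neighbourhood has a private neighbour [w], and exchanging
   one end of the edge for [x] enlarges the neighbourhood. *)
Lemma dominating_edge v : (exists u, adj v u) ->
  exists p : G * G, adj p.1 p.2 /\ forall z, near v z -> adj p.1 z || adj p.2 z.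
Proof.
move=> [v' vv'].
pose Q (p : G * G) := adj p.1 p.2 && near v p.1.
have Q0 : Q (v, v') by rewrite /Q vv' near_refl.
have [[a b] /andP[/= ab va] mx] := @arg_maxnP _ (v, v') Q (fun p => #|N p.1 p.2|) Q0.
have vb : near v b by apply: near_adj_trans va ab.
have step x w : x \in N a b -> adj x w -> w \in N a b.
  move=> xN xw; apply: contraT => wN.
  have [wa wb] : ~~ adj a w /\ ~~ adj b w by move: wN; rewrite inE negb_or => /andP[].
  (* The edge [(p, x)] beats [(p, q)]. A neighbour [y] of [q] adjacent to neither [p] nor [x] would
     be adjacent to [w], because [y], [q], [x], [w] needs a chord, and then [p], [x], [w], [y] would
     be induced. So nothing is lost, and [w] is gained. *)
  have key p q : adj p q -> near v p -> N p q = N a b -> adj p x -> False.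
    move=> pq vp Npq px.
    have [wp wq] : ~~ adj p w /\ ~~ adj q w.
      by move: wN; rewrite -Npq inE negb_or => /andP[].
    have qw : q != w by apply: contraNneq wp => <-.
    have pw : p != w by apply: contraNneq wq => <-; rewrite adj_sym.
    have qx : adj q x.
      have := path4_chord (_ : adj q p) px xw qw.
      by rewrite (negbTE wp) (negbTE wq) !orbF adj_sym; apply.
    have /(_ (p, x)) := mx.
    rewrite /Q /= px vp => /(_ isT); rewrite -Npq leqNgt => /negP; apply.
    apply: proper_card; apply/properP; split; last first.
      by exists w; rewrite inE ?xw ?orbT // negb_or wp.
    apply/subsetP => y; rewrite !inE => /orP[->//|qy].
    apply: contraT; rewrite negb_or => /andP[npy nxy].
    have yw : y != w by apply: contraNneq wq => <-.
    have wy : adj w y.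
      have := path4_chord (_ : adj y q) qx xw yw.
      by rewrite (@adj_sym G y x) (negbTE nxy) (negbTE wq) /= adj_sym (@adj_sym G w y); apply.
    have py : p != y by apply: contraNneq nxy => <-; rewrite adj_sym.
    have := path4_chord px xw wy py.
    by rewrite (negbTE wp) (negbTE nxy) (negbTE npy).
  case: (boolP (adj a x)) xN => [ax _|nax].
    by case: (key a b ab va erefl ax).
  rewrite inE (negbTE nax) => bx.
  case: (key b a _ vb _ bx); first by rewrite adj_sym.
  by apply/setP => y; rewrite !inE orbC.
exists (a, b); split=> // z vz /=.
suff : z \in N a b by rewrite inE.
have az : near a z by apply: near_trans vz; rewrite near_sym.
have aN : a \in N a b by rewrite inE (@adj_sym G b a) ab orbT.
case/or3P: az => [/eqP<-//|az|/existsP[w /andP[aw wz]]]; first by rewrite inE az.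
by apply: step wz; rewrite inE aw.
Qed.

Variable rank : G -> nat.
Hypothesis rank_inj : injective rank.
(** The vertex of least rank in each component. *)
Definition reps := [set v | [forall u, (rank u < rank v) ==> ~~ near u v]].

Lemma reps_near u v : u \in reps -> v \in reps -> near u v -> u = v.
Proof.
rewrite !inE => /forallP Hu /forallP Hv uv.
apply: rank_inj; apply/eqP; rewrite eqn_leq; apply/andP; split; rewrite leqNgt.
  by apply/negP => H; have := Hu v; rewrite H near_sym uv.
by apply/negP => H; have := Hv u; rewrite H uv.
Qed.

Lemma reps_ex u : exists2 v, v \in reps & near u v.
Proof.
have [v uv mn] := @arg_minnP _ u (near u) rank (near_refl u).
exists v => //; rewrite inE; apply/forallP => w; apply/implyP => wv.
by apply/negP => H; have := mn w; rewrite (near_trans uv) 1?near_sym // leqNgt wv; move/(_ isT).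
Qed.

(** For the lower bound, a representative has a neighbour in [D], which in turn has a neighbour in
    [D]; these two are adjacent, hence distinct, and lie in its component. For the upper bound, the
    ends of one dominating edge per component are taken. *)
Lemma total_dominating_P4free k : (forall v, exists u, adj v u) ->
  (exists2 D : {set G}, total_dominating D & #|D| <= k) <-> #|reps|.*2 <= k.
Proof.
move=> noiso; split=> [[D tD Dk]|rk].
  have H v : exists u, (u \in D) && adj v u.
    by case: (tD v) => u uD vu; exists u; rewrite uD.
  pose h v := xchoose (H v).
  have hD v : h v \in D by case/andP: (xchooseP (H v)).
  have hA v : adj v (h v) by case/andP: (xchooseP (H v)).
  pose f (p : G * bool) := if p.2 then h (h p.1) else h p.1.
  have fn p : near p.1 (f p).
    rewrite /f; case: p.2; last exact: near_adj.
    exact: near_adj_trans (near_adj (hA _)) (hA _).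
  have fI : {in setX reps [set: bool] &, injective f}.
    move=> [u b] [v c]; rewrite !inE !andbT => uR vR E.
    have uv : near u v.
      apply: near_trans (fn (u, b)) _; rewrite E near_sym; exact: (fn (v, c)).
    have uv' : u = v by apply: reps_near; rewrite ?inE.
    subst v; congr pair; move: E; rewrite /f /=.
    by case: b c uR vR => [] [] _ _ // E; have := hA (h u); first [by rewrite E adj_irr | by rewrite -E adj_irr].
  rewrite -muln2 -card_bool -cardsT -cardsX -(card_in_imset fI).
  apply: leq_trans Dk; apply: subset_leq_card; apply/subsetP => _ /imsetP[p _ ->].
  by rewrite /f; case: p.2.
have H v : exists p : G * G,
    adj p.1 p.2 && [forall z, near v z ==> (adj p.1 z || adj p.2 z)].
  have [p [p1 p2]] := dominating_edge (noiso v); exists p; rewrite p1.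
  by apply/forallP => z; apply/implyP/p2.
pose h v := xchoose (H v).
pose f (p : G * bool) := if p.2 then (h p.1).1 else (h p.1).2.
exists (f @: setX reps [set: bool]); last first.
  by apply: leq_trans (leq_imset_card _ _) _; rewrite cardsX cardsT card_bool muln2.
move=> u; have [v vR uv] := reps_ex u.
have /andP[_ /forallP/(_ u)] := xchooseP (H v).
rewrite -/(h v) near_sym uv => /orP[] A.
  exists (f (v, true)); rewrite ?[adj u _]adj_sym //; apply: imset_f; rewrite inE vR inE //.
exists (f (v, false)); rewrite ?[adj u _]adj_sym //; apply: imset_f; rewrite inE vR inE //.
Qed.
End P4free.

(* A maximal independent set [J] among the vertices not dominated by the induced path has
   fewer than [r] elements; take the path, [J], and one neighbour of each element of [J]. *)
Lemma total_dominating_path4 r (a b c d : G) : path4 a b c d ->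
  free_of (dunion (path_graph 4) (edgeless_graph r)) G ->
  (forall v, exists u, adj v u) ->
  exists2 D : {set G}, total_dominating D & #|D| <= r.*2 + 4.
Proof.
move=> P4 /free_ofP fr noiso.
have [[ab bc cd] [ac bd ad ad']] : [/\ adj a b, adj b c & adj c d] /\
    [/\ ~~ adj a c, ~~ adj b d, ~~ adj a d & a != d].
  by case/and5P: P4 => ? ? ? ? /and3P[].
pose P := [set x in [:: a; b; c; d]].
pose W := [set v | [forall p in P, ~~ adj v p]].
pose indep (J : {set G}) := (J \subset W) && [forall u in J, forall v in J, ~~ adj u v].
have [J /maxsetP[/andP[JW /forall_inP Ji] Jmax]] : {J | maxset indep J}.
  by apply: ex_maxset; exists set0; rewrite /indep sub0set; apply/forall_inP => u; rewrite inE.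
have Jind u v : u \in J -> v \in J -> adj u v = false.
  by move=> uJ vJ; apply/negbTE; have /forall_inP := Ji u uJ; apply.
have JP u p : u \in J -> p \in P -> adj u p = false.
  by move=> uJ pP; move/subsetP: JW => /(_ u uJ); rewrite inE => /forall_inP /(_ p pP) /negbTE.
have Jr : #|J| <= r.
  (* Otherwise the path and the first [r] elements of [J] form the forbidden graph. *)
  rewrite leqNgt; apply/negP => rJ; apply: fr.
  pose f (x : dunion (path_graph 4) (edgeless_graph r)) : G := match x with
    | inl i => nth a [:: a; b; c; d] i
    | inr j => nth a (enum J) j end.
  have fP i : f (inl i) \in P.
    by case: i => -[|[|[|[|i]]]] //= Hi; rewrite !inE eqxx ?orbT.
  have fJ j : f (inr j) \in J.
    by rewrite -mem_enum mem_nth // -cardE; apply: ltn_trans rJ.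
  have fA (x y : dunion (path_graph 4) (edgeless_graph r)) : adj (f x) (f y) = adj x y.
    case: x y => [i|i] [j|j]; last by rewrite Jind.
    - have ba : adj b a by rewrite adj_sym.
      have cb : adj c b by rewrite adj_sym.
      have dc : adj d c by rewrite adj_sym.
      move: ac bd ad => ac1 bd1 ad1.
      have ca : ~~ adj c a by rewrite adj_sym.
      have db : ~~ adj d b by rewrite adj_sym.
      have da : ~~ adj d a by rewrite adj_sym.
      by case: i j => -[|[|[|[|i]]]] //= Hi [[|[|[|[|j]]]]] //= Hj;
         rewrite /path_adj /= ?adj_irr //; apply/negbTE.
    - by rewrite adj_sym JP.
    - by rewrite JP.
  exists f => // x y E.
  case: x y E => [i|i] [j|j] E.
  - have := adjN ab; have := adjN bc; have := adjN cd.
    move=> cd' bc' ab'.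
    have ac' : a != c by apply: contraNneq ad => ->.
    have bd' : b != d by apply: contraNneq ad => <-.
    congr inl; apply: val_inj; apply/eqP.
    have U : uniq [:: a; b; c; d].
      by rewrite /= !inE !negb_or ab' ac' ad' bc' bd' cd'.
    have sE (l : 'I_4) : l < size [:: a; b; c; d] := ltn_ord l.
    by rewrite -(nth_uniq a (sE i) (sE j) U); apply/eqP.
  (* Each path vertex has a neighbour on the path, whereas no element of [J] has one. *)
  - have Q : f (inl i) \in J by rewrite E.
    exfalso; have := fP i.
    by rewrite !inE => /or4P[]/eqP Z; rewrite Z in Q;
      [have := JP a b Q|have := JP b a Q|have := JP c b Q|have := JP d c Q];
      rewrite !inE eqxx ?orbT 1?adj_sym ?ab ?bc ?cd 1?(@adj_sym G b a) ?ab => /(_ isT).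
  - have Q : f (inl j) \in J by rewrite -E.
    exfalso; have := fP j.
    by rewrite !inE => /or4P[]/eqP Z; rewrite Z in Q;
      [have := JP a b Q|have := JP b a Q|have := JP c b Q|have := JP d c Q];
      rewrite !inE eqxx ?orbT 1?adj_sym ?ab ?bc ?cd 1?(@adj_sym G b a) ?ab => /(_ isT).
  - congr inr; apply: val_inj; apply/eqP.
    have rE (l : 'I_r) : l < size (enum J) by rewrite -cardE (ltn_trans (ltn_ord l)).
    by rewrite -(nth_uniq a (rE i) (rE j) (enum_uniq J)); apply/eqP.
have Hn v : exists u, adj v u by [].
pose h v := xchoose (Hn v).
exists (P :|: (J :|: h @: J)).
  move=> v; case: (boolP (v \in W)) => vW; last first.
    move: vW; rewrite inE negb_forall_in => /exists_inP[p pP]; rewrite negbK => vp.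
    by exists p => //; rewrite inE pP.
  case: (boolP (v \in J)) => vJ.
    by exists (h v); [rewrite !inE imset_f ?orbT|exact: (xchooseP (Hn v))].
  case: (boolP [exists u in J, adj v u]) => [/exists_inP[u uJ vu]|].
    by exists u => //; rewrite !inE uJ !orbT.
  (* A vertex of [W] outside [J] without neighbours in [J] could be added to [J], against
     maximality. *)
  rewrite negb_exists_in => /forall_inP nv.
  case/negP: vJ; rewrite -(Jmax (v |: J)) ?setU11 ?subsetUr //.
  rewrite /indep subUset sub1set vW JW /=.
  apply/forall_inP => x; rewrite !inE => Hx; apply/forall_inP => y; rewrite !inE => Hy.
  case/orP: Hx => [/eqP->|xJ]; case/orP: Hy => [/eqP->|yJ].
  - by rewrite adj_irr.
  - exact: nv.
  - by rewrite adj_sym nv.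
  - by rewrite Jind.
(* The path contributes 4 vertices, [J] and the chosen neighbours at most [r] each. *)
have PP : #|P| <= 4 by rewrite cardsE card_size.
have [H0 _] := leq_card_setU P (J :|: h @: J).
have [H1 _] := leq_card_setU J (h @: J).
by have := leq_imset_card h J; lia.
Qed.

End Graph.

(** * The decision procedure *)

Section Algorithm.
Variable m : nat.

Definition Has (s : seq nat) (F : nat -> cmd) := foldr (fun i c => Or (F i) c) (Fin false) s.

Lemma decides_has d s F p : (forall i, i \in s -> decides m d (F i) (p i)) ->
  decides m d (Has s F) (fun I e => has (fun i => p i I e) s).
Proof.
elim: s => [|i s IH] H; first exact: decides_fin.
apply: decides_or; first by apply: H; rewrite mem_head.
by apply: IH => j js; apply: H; rewrite in_cons js orbT.
Qed.

Fixpoint Exs j d c := if j is j'.+1 then Ex d (Exs j' d.+1 c) else c.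

Fixpoint updseq (e : nat -> nat) d s :=
  if s is x :: s' then updseq (upd e d x) d.+1 s' else e.

Lemma updseqE (e : nat -> nat) (d : nat) s i :
  updseq e d s i = if d <= i < d + size s then nth 0 s (i - d) else e i.
Proof.
elim: s e d => [|x s IH] e d /=; first by case: ifP => // H; exfalso; lia.
rewrite IH /upd addSnnS; case: (ltngtP d i) => [di|di|->] //=.
  by rewrite -(subnSK di).
by rewrite subnn ifT //; lia.
Qed.

Fixpoint exs (phi : inst -> (nat -> nat) -> bool) j d I e :=
  if j is j'.+1 then has (fun x => exs phi j' d.+1 I (upd e d x)) (iota 0 (isz I))
  else phi I e.

Lemma exsP (phi : inst -> (nat -> nat) -> bool) j d I e : reflect
  (exists s, [/\ size s = j, all (ltn^~ (isz I)) s & phi I (updseq e d s)])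
  (exs phi j d I e).
Proof.
elim: j d e => [|j IH] d e /=.
  apply: (iffP idP) => [H|[s [/size0nil-> //]]].
  by exists [::].
apply: (iffP hasP) => [[x xI /IH[s [sj sI H]]]|[[|x s] [//= [sj] /andP[xI sI] H]]].
  rewrite mem_iota /= in xI.
  by exists (x :: s); rewrite /= sj sI xI.
by exists x; rewrite ?mem_iota //; apply/IH; exists s.
Qed.

Lemma decides_exs j d c phi : 4 <= d -> d + j <= m.+1 -> decides m (d + j) c phi ->
  decides m d (Exs j d c) (exs phi j d).
Proof.
elim: j d => [|j IH] d d4 dj H; first by rewrite addn0 in H.
by apply: decides_ex; [lia|apply: IH; rewrite ?addSnnS //; lia].
Qed.

Definition Dom j := Exs j 4 (All (4 + j) (Has (iota 4 j) (fun i => Adj (4 + j) i))).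

(** The form that [decides_exs] and [decides_all] produce; [domP] brings it into readable shape. *)
Definition dom j := exs (fun I e => all (fun v => has (fun i =>
  iadj I (upd e (4 + j) v (4 + j)) (upd e (4 + j) v i)) (iota 4 j)) (iota 0 (isz I))) j 4.

Lemma decides_dom j : 4 + j <= m -> decides m 4 (Dom j) (dom j).
Proof.
move=> jm; apply: decides_exs => //; first by lia.
apply: (decides_all (phi := fun I e => has (fun i => iadj I (e (4 + j)) (e i)) (iota 4 j)));
  first by lia.
apply: (decides_has (p := fun i I e => iadj I (e (4 + j)) (e i))) => i.
by rewrite mem_iota => ij; apply: decides_adj; lia.
Qed.

(** Entries of [s] may repeat, so length exactly [j] stands for a set of at most [j] vertices. *)
Lemma domP j I e : reflect
  (exists s, [/\ size s = j, all (ltn^~ (isz I)) s &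
     all (fun v => has (iadj I v) s) (iota 0 (isz I))])
  (dom j I e).
Proof.
suff E s : size s = j -> all (fun v => has (fun i =>
    iadj I (upd (updseq e 4 s) (4 + j) v (4 + j)) (upd (updseq e 4 s) (4 + j) v i))
    (iota 4 j)) (iota 0 (isz I)) = all (fun v => has (iadj I v) s) (iota 0 (isz I)).
  by apply: (iffP (exsP _ _ _ _ _)) => -[s [sj sI H]]; exists s; split=> //; move: H; rewrite E.
move=> sj; apply: eq_all => v.
have -> : iota 4 j = map (addn 4) (iota 0 j) by rewrite -iotaDl.
rewrite has_map -{3}(mkseq_nth 0 s) sj has_map; apply: eq_in_has => i.
rewrite mem_iota => /andP[_ ij]; rewrite /= {1}/upd eqxx /upd ifF; last by lia.
by rewrite updseqE sj ifT ?addKn //; lia.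
Qed.

Definition Small K := Has (iota 0 K.+1) (fun j => And (Kge j) (Dom j)).

Lemma decides_small K : 4 + K <= m -> decides m 4 (Small K)
  (fun I e => has (fun j => (j <= e 1) && dom j I e) (iota 0 K.+1)).
Proof.
move=> Km; apply: decides_has => j; rewrite mem_iota => jK.
by apply: decides_and; [apply: decides_kge|apply: decides_dom]; lia.
Qed.

Definition NoIso := All 4 (Ex 5 (Adj 4 5)).

Lemma decides_noiso : 5 <= m -> decides m 4 NoIso
  (fun I _ => all (fun v => has (iadj I v) (iota 0 (isz I))) (iota 0 (isz I))).
Proof.
move=> m5; apply: (decides_all (phi := fun I e => has (iadj I (e 4)) (iota 0 (isz I))));
  first by lia.
apply: (decides_ex (phi := fun I e => iadj I (e 4) (e 5))); first by lia.
by apply: decides_adj; lia.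
Qed.

Definition Rep := Not (Ex 5 (And (Lt 5 4) (Or (Adj 5 4) (Ex 6 (And (Adj 5 6) (Adj 6 4)))))).

(** The numerical counterpart of [reps]; as [u < x], the case of equality in [near] cannot occur. *)
Definition rep I x := ~~ has (fun u => (u < x) &&
   (iadj I u x || has (fun w => iadj I u w && iadj I w x) (iota 0 (isz I)))) (iota 0 (isz I)).

Lemma decides_rep : 6 <= m -> decides m 5 Rep (fun I e => rep I (e 4)).
Proof.
move=> m6; apply: decides_not; apply: (decides_ex (phi := fun I e => (e 5 < e 4) &&
  (iadj I (e 5) (e 4) || has (fun w => iadj I (e 5) w && iadj I w (e 4)) (iota 0 (isz I)))));
  first by lia.
apply: decides_and; first by apply: decides_lt; lia.
apply: decides_or; first by apply: decides_adj; lia.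
apply: (decides_ex (phi := fun I e => iadj I (e 5) (e 6) && iadj I (e 6) (e 4))); first by lia.
by apply: decides_and; apply: decides_adj; lia.
Qed.

Definition Main K :=
  If (Small K) (Fin true) (If (And (Kge K) NoIso) (Count2 Rep) (Fin false)).

Definition answer K I :=
  has (fun j => (j <= ik I) && dom j I (env_init I)) (iota 0 K.+1) ||
  [&& K <= ik I, all (fun v => has (iadj I v) (iota 0 (isz I))) (iota 0 (isz I)) &
      (count (rep I) (iota 0 (isz I))).*2 <= ik I].

(** [Rep] binds the tapes 4, 5 and 6, and [Dom j] with [j <= K] binds 4 up to [4 + j]; the bound
    [6 + K] covers both. *)
Lemma runs_main K : 6 + K <= m -> exists2 f, pbound f & forall I, ik I <= isz I ->
  exists M, runs (Seq (Init) (Main K)) (@Memory m (fun=> 0) (tape_init (word I)))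
     (f (isz I)) M (Some (answer K I)).
Proof.
move=> Km.
have [m1 m4 m5 m6 mK] : [/\ 1 <= m, 4 <= m, 5 <= m, 6 <= m & 4 + K <= m] by split; lia.
have [f1 p1 H1] := decides_small mK.
have [f2 p2 H2] := decides_and (decides_kge 4 K m1) (decides_noiso m5).
have [f3 p3 H3] := runs_count2 m4 (decides_rep m6) (fun I e e' E => congr1 (rep I) E).
exists (fun n => n.+1 * 6 + 3 + (f1 n + (f2 n + (f3 n + 1)))).
  by do !first [assumption | exact: pbound_const | exact: pbound_id
       | apply: pboundS | apply: pboundD | apply: pboundM].
move=> I kn; have g := good_init I (leqnn 4).
have {}H1 := H1 I _ g; have {}H2 := H2 I _ g.
have [M {}H3] := H3 I _ g.
have e1 : env_init I 1 = ik I by [].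
rewrite e1 in H1 H2 H3; rewrite /answer.
set a := has _ _ in H1 *; set b := _ && all _ _ in H2.
case Ea : a H1 => H1.
  exists (layout _ (cell I) (env_init I)); apply: runs_seq; first by apply: runs_init => //; lia.
  apply: runs_if H1 _; apply: runs_le (runs_ret _ _); lia.
rewrite andbA -/b; case Eb: b H2 => H2.
  exists M; apply: runs_seq; first by apply: runs_init => //; lia.
  apply: runs_if H1 _; apply: runs_if H2 _.
  by apply: runs_le H3; lia.
exists (layout _ (cell I) (env_init I)); apply: runs_seq; first by apply: runs_init => //; lia.
apply: runs_if H1 _; apply: runs_if H2 _.
by apply: runs_le (runs_ret _ _); lia.
Qed.

End Algorithm.

(** * Correctness of the procedure on graphs *)

Section Instance.
Variables (G : sgraph) (v0 : G) (k : nat).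
Hypothesis G_gt0 : 0 < #|G|.

Definition vtx i := nth v0 (enum G) i.
Definition idx (v : G) := index v (enum G).
Definition inst_of := @Inst #|G| k (fun i j => adj (vtx i) (vtx j)) G_gt0.

Lemma idxK : cancel idx vtx.
Proof. by move=> v; rewrite /vtx nth_index // mem_enum. Qed.

Lemma idx_lt v : idx v < #|G|.
Proof. by rewrite cardE index_mem mem_enum. Qed.

Lemma vtxK i : i < #|G| -> idx (vtx i) = i.
Proof. by move=> iG; rewrite /idx index_uniq ?enum_uniq -?cardE. Qed.

Lemma enumE : enum G = map vtx (iota 0 #|G|).
Proof. by rewrite -[LHS](mkseq_nth v0) cardE. Qed.

Lemma word_inst_of : word inst_of = encode_tds (G, k).
Proof.
by rewrite /word /= enumE allpairs_mapl allpairs_mapr.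
Qed.

Lemma all_vtx (P : pred nat) : reflect (forall v, P (idx v)) (all P (iota 0 #|G|)).
Proof.
apply: (iffP allP) => [H v|H i]; first by apply: H; rewrite mem_iota idx_lt.
by rewrite mem_iota => /andP[_ iG]; rewrite -(vtxK iG).
Qed.

Lemma has_vtx (P : pred nat) : reflect (exists v, P (idx v)) (has P (iota 0 #|G|)).
Proof.
apply: (iffP hasP) => [[i]|[v Pv]]; last by exists (idx v); rewrite // mem_iota idx_lt.
by rewrite mem_iota => /andP[_ iG]; rewrite -{1}(vtxK iG); exists (vtx i).
Qed.

Lemma dom_total j e : dom j inst_of e ->
  exists2 D : {set G}, total_dominating D & #|D| <= j.
Proof.
case/domP=> s [sj sI /all_vtx H]; exists [set x in map vtx s]; last first.
  by rewrite cardsE -sj -(size_map vtx) card_size.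
move=> v; have /hasP[i si vi] := H v; exists (vtx i); first by rewrite inE map_f.
by rewrite /= idxK in vi.
Qed.

Lemma total_dom (D : {set G}) e : total_dominating D -> dom #|D| inst_of e.
Proof.
move=> tD; apply/domP; exists (map idx (enum D)); split.
- by rewrite size_map -cardE.
- by apply/allP => _ /mapP[v _ ->]; apply: idx_lt.
apply/all_vtx => v; have [u uD vu] := tD v; apply/hasP.
by exists (idx u); [rewrite map_f // mem_enum|rewrite /= !idxK].
Qed.

Lemma noisoP : reflect (forall v : G, exists u, adj v u)
  (all (fun v => has (iadj inst_of v) (iota 0 #|G|)) (iota 0 #|G|)).
Proof.
apply: (iffP (all_vtx _)) => H v; have := H v.
  by case/has_vtx=> u; rewrite /= !idxK; exists u.
by case=> u vu; apply/has_vtx; exists u; rewrite /= !idxK.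
Qed.

Lemma count_rep : count (rep inst_of) (iota 0 #|G|) = #|reps idx|.
Proof.
rewrite cardE /enum_mem -enumT size_filter enumE count_map; apply: eq_in_count => x.
rewrite mem_iota => /andP[_ xG] /=; rewrite -{1}(vtxK xG); move: (vtx x) => {x xG} v.
rewrite /rep !inE; apply/idP/forallP => [H u|H].
  apply/implyP => uv; apply: contra H => H; apply/has_vtx; exists u; rewrite uv /= !idxK.
  case/or3P: H => [/eqP E|->//|/existsP[w H]]; first by rewrite E ltnn in uv.
  by apply/orP; right; apply/has_vtx; exists w; rewrite idxK.
apply/negP => /has_vtx[u /andP[uv]]; rewrite /= !idxK => Q.
have := H u; rewrite uv => /negP; apply; rewrite /near.
case/orP: Q => [->|/has_vtx[w]]; first by rewrite orbT.
by rewrite /= idxK => Q; apply/or3P/Or33/existsP; exists w.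
Qed.

(** A total dominating set excludes isolated vertices. If it has more than [K] elements, then
    [K <= k], and either an induced P4 yields another one of size at most [K], found by the search,
    or the graph is P4-free and the count of representatives decides. *)
Lemma answerP r : free_of (dunion (path_graph 4) (edgeless_graph r)) G ->
  answer (r.*2 + 4) inst_of <-> tds_yes (G, k).
Proof.
move=> fr; set K := r.*2 + 4.
have idxI : injective idx by apply: can_inj idxK.
have path_cases : (exists p : G * G * G * G, path4 p.1.1.1 p.1.1.2 p.1.2 p.2) \/
    (forall a b c d : G, ~~ path4 a b c d).
  case: (boolP [exists p : G * G * G * G, path4 p.1.1.1 p.1.1.2 p.1.2 p.2]).
    by move/existsP; left.
  by rewrite negb_exists => /forallP H; right=> a b c d; apply: (H (a, b, c, d)).
rewrite /answer count_rep; split=> [/orP[/hasP[j _ /andP[jk dj]]|/and3P[Kk ni0 ck]]|].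
- have [D tD Dj] := dom_total dj; exists D => //=; exact: leq_trans Dj jk.
- have ni := elimT noisoP ni0; case: path_cases => [[p p4]|np].
    have [D tD DK] := total_dominating_path4 p4 fr ni.
    by exists D => //=; apply: leq_trans DK Kk.
  exact/(total_dominating_P4free np idxI).
- case=> /= D tD Dk.
  have sm (D' : {set G}) : total_dominating D' -> #|D'| <= k -> #|D'| <= K ->
      has (fun j => (j <= k) && dom j inst_of (env_init inst_of)) (iota 0 K.+1).
    move=> tD' D'k D'K; apply/hasP; exists #|D'|; first by rewrite mem_iota ltnS.
    by rewrite D'k total_dom.
  have ni (v : G) : exists u, adj v u by case: (tD v) => u _; exists u.
  case: (leqP #|D| K) => DK; first by apply/orP; left; apply: (sm D).
  have Kk : K <= k by apply: leq_trans Dk; apply: ltnW.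
  case: path_cases => [[p p4]|np].
    have [D' tD' D'K] := total_dominating_path4 p4 fr ni.
    by apply/orP; left; apply: (sm D') => //; apply: leq_trans D'K Kk.
  apply/orP; right; apply/and3P; split=> //; first exact/noisoP.
  by apply/(total_dominating_P4free np idxI) => //; exists D.
Qed.
End Instance.

(** * Polynomial-time solvability on the four classes *)

Lemma tds_polytime_P4 r :
  tds_polytime_on (free_of (dunion (path_graph 4) (edgeless_graph r))).
Proof.
set K := r.*2 + 4; set m := 6 + K.
have [f [p fp] H] := runs_main (leqnn m).
exists (machine m (Seq Init (Main K))), p => -[G k] [/= fr /andP[k0 kG]].
have G0 : 0 < #|G| by apply: leq_trans kG.
have [v0 _] := card_gt0P G0.
exists (answer K (inst_of v0 k G0)); last exact: answerP.
have [M [t tf]] := H (inst_of v0 k G0) kG.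
rewrite word_inst_of => R.
exists t; last by have := run_machine R => ->.
(* The time bound is a polynomial in the number of vertices, which is at most the length of the
   input. *)
have sz : #|G| <= size (encode_tds (G, k)).
  by rewrite -(word_inst_of v0 k G0) size_word /=; lia.
exact: leq_trans tf (leq_trans (fp _) (horner_leq p sz)).
Qed.

Lemma tds_polytime_sub (C C' : sgraph -> Prop) : (forall G, C' G -> C G) ->
  tds_polytime_on C -> tds_polytime_on C'.
Proof.
move=> CC' [M [p H]]; exists M, p => x [/CC' Cx kx]; exact: H.
Qed.

Theorem theorem7 (r : nat) :
  [/\ tds_polytime_on (free_of (dunion (path_graph 4) (edgeless_graph r))),
      tds_polytime_on (free_of (dunion (path_graph 3) (edgeless_graph r))),
      tds_polytime_on (free_of (dunion (complete_graph 2) (edgeless_graph r)))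
    & tds_polytime_on (free_of (edgeless_graph r))].
Proof.
split; first exact: tds_polytime_P4; apply: tds_polytime_sub (tds_polytime_P4 r) => G;
  apply: free_of_embeds.
- exact/embeds_dunion/embeds_path.
- exact/embeds_dunion/embeds_edge_path.
- exact: embeds_inr.
Qed.
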